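(* For every integer $n\ge 0$ and every complex number $a$, $$x^n=\sum_{k=0}^n(-1)^k q^{-\binom{k}{2}}\begin{bmatrix} n\\ k\end{bmatrix}_{p,q}(aq^{-k})^{n-k}(a\ominus x)_{p,q}^k .$$
   Context: $p,q$ are nonzero complex numbers with $p^n\neq q^n$ for all integers $n\ge 1$. $[n]_{p,q}=\dfrac{p^n-q^n}{p-q}$, $[n]_{p,q}!=\prod_{k=1}^{n}[k]_{p,q}$ for $n\ge 1$, $[0]_{p,q}!=1$, and $\begin{bmatrix} n\\ k\end{bmatrix}_{p,q}=\dfrac{[n]_{p,q}!}{[k]_{p,q}!\,[n-k]_{p,q}!}$ for $0\le k\le n$. The $(p,q)$-power is $(u\ominus v)_{p,q}^n=(u-v)(pu-qv)\cdots(p^{n-1}u-q^{n-1}v)$ for $n\ge 1$ and $(u\ominus v)_{p,q}^0=1$. *)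

(* Defs.v *)
From mathcomp Require Import all_boot all_order all_algebra.
Set Implicit Arguments.
Unset Strict Implicit.
Unset Printing Implicit Defensive.
Import GRing.Theory.
Local Open Scope ring_scope.

Section PQCalculus.
Variable F : fieldType.
Implicit Types (p q u v : F) (n k : nat).

Definition pq_num p q n : F := (p ^+ n - q ^+ n) / (p - q).

Definition pq_fact p q n : F := \prod_(1 <= k < n.+1) pq_num p q k.

(* Meaningful only for k <= n, since n - k is truncated subtraction. *)
Definition pq_binom p q n k : F :=
  pq_fact p q n / (pq_fact p q k * pq_fact p q (n - k)).

(* (u - v) (p u - q v) ... (p^(n-1) u - q^(n-1) v) *)
Definition pq_pow p q u v n : F :=
  \prod_(0 <= i < n) (p ^+ i * u - q ^+ i * v).

End PQCalculus.

(* Main.v *)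
(* Multiplying the expansion of x^n by x and using
     x (a (-) x)^k = q^-k (p^k a (a (-) x)^k - (a (-) x)^(k+1))
   turns the claim for n + 1 into the Pascal rule
     [n+1, k+1] = p^(k+1) [n, k+1] + q^(n-k) [n, k]. *)
Require Import Defs.
From mathcomp Require Import all_boot all_order all_algebra.
From mathcomp Require Import reals complex.
From mathcomp Require Import ring.
Set Implicit Arguments.
Unset Strict Implicit.
Unset Printing Implicit Defensive.
Import Order.TTheory GRing.Theory Num.Theory.
Local Open Scope ring_scope.

Section PQTaylor.
Variables (F : fieldType) (p q : F).
Hypothesis q_neq0 : q != 0.
Hypothesis pq_neq : forall m : nat, (1 <= m)%N -> p ^+ m != q ^+ m.

Lemma pq_sub_neq0 : p - q != 0.
Proof. by rewrite subr_eq0 -[p]expr1 -[q]expr1 pq_neq. Qed.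

Lemma pq_num_neq0 n : pq_num p q n.+1 != 0.
Proof. by rewrite mulf_neq0 ?invr_neq0 ?pq_sub_neq0 // subr_eq0 pq_neq. Qed.

(** Add and subtract [p ^+ m * q ^+ n] in the numerator. *)
Lemma pq_numD m n :
  pq_num p q (m + n) = p ^+ m * pq_num p q n + q ^+ n * pq_num p q m.
Proof. by rewrite /pq_num !exprD; field; exact: pq_sub_neq0. Qed.

Lemma pq_factS n : pq_fact p q n.+1 = pq_fact p q n * pq_num p q n.+1.
Proof. by rewrite /pq_fact big_nat_recr. Qed.

Lemma pq_fact_neq0 n : pq_fact p q n != 0.
Proof.
elim: n => [|n IHn]; first by rewrite /pq_fact big_nil oner_neq0.
by rewrite pq_factS mulf_neq0 ?pq_num_neq0.
Qed.

Lemma pq_binom0 n : pq_binom p q n 0 = 1.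
Proof.
by rewrite /pq_binom subn0 {2}/pq_fact big_nil mul1r divff ?pq_fact_neq0.
Qed.

Lemma pq_binomnn n : pq_binom p q n n = 1.
Proof.
by rewrite /pq_binom subnn {3}/pq_fact big_nil mulr1 divff ?pq_fact_neq0.
Qed.

(** Clearing factorials leaves [pq_numD] at [k.+1] and [n - k]. The case [k = n] is excluded:
    truncated subtraction makes [pq_binom p q n n.+1] the inverse of [pq_num p q n.+1], not 0. *)
Lemma pq_binomS n k : (k < n)%N ->
  pq_binom p q n.+1 k.+1 =
  p ^+ k.+1 * pq_binom p q n k.+1 + q ^+ (n - k) * pq_binom p q n k.
Proof.
move=> /subnKC; move: (n - k.+1)%N => m <-.
rewrite /pq_binom subSS addKn addSnnS addKn !pq_factS -addSn pq_numD.
by field; rewrite !pq_fact_neq0 !pq_num_neq0.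
Qed.

Lemma pq_powS u v n :
  pq_pow p q u v n.+1 = pq_pow p q u v n * (p ^+ n * u - q ^+ n * v).
Proof. by rewrite /pq_pow big_nat_recr. Qed.

Definition pq_taylor_coef (a : F) n k : F :=
  (-1) ^+ k * q ^- 'C(k, 2) * pq_binom p q n k * (a * q ^- k) ^+ (n - k).

Lemma pq_taylor_coef0 a n : pq_taylor_coef a n 0 = a ^+ n.
Proof.
by rewrite /pq_taylor_coef pq_binom0 subn0 bin0n !expr0 invr1 !mulr1 !mul1r.
Qed.

Lemma exprVn_binS2 k : q ^- 'C(k.+1, 2) = q ^- 'C(k, 2) * q ^- k.
Proof. by rewrite binS bin1 exprD invfM. Qed.

(** The diagonal lies outside the range of the Pascal rule; here only the sign and the power of [q]
    change. *)
Lemma pq_taylor_coefnn a n :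
  pq_taylor_coef a n.+1 n.+1 = - (pq_taylor_coef a n n * q ^- n).
Proof.
rewrite /pq_taylor_coef !pq_binomnn !subnn !expr0 exprVn_binS2 exprS.
by ring.
Qed.

(** The two Pascal terms yield the two terms on the right, one each. *)
Lemma pq_taylor_coefS a n k : (k < n)%N ->
  pq_taylor_coef a n.+1 k.+1 =
  pq_taylor_coef a n k.+1 * q ^- k.+1 * p ^+ k.+1 * a
  - pq_taylor_coef a n k * q ^- k.
Proof.
move=> lt_kn; rewrite /pq_taylor_coef pq_binomS // subSS exprVn_binS2.
have -> : (n - k = (n - k.+1).+1)%N by rewrite -subSn.
move: (n - k.+1)%N => m.
(* The denominator split off here cancels the factor [q ^+ (n - k)] of the second Pascal term. *)
have qE : (q ^- k.+1) ^+ m.+1 = (q ^- k) ^+ m.+1 / q ^+ m.+1.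
  by rewrite [q ^+ k.+1]exprSr invfM exprMn [q^-1 ^+ _]exprVn.
have -> : (a * q ^- k.+1) ^+ m.+1 = a ^+ m.+1 * ((q ^- k) ^+ m.+1 / q ^+ m.+1).
  by rewrite exprMn qE.
have aqE : (a * q ^- k.+1) ^+ m * q ^- k.+1 * a =
    a ^+ m.+1 * ((q ^- k) ^+ m.+1 / q ^+ m.+1).
  by rewrite -qE; move: (q ^- k.+1) => w; rewrite exprMn !exprSr; ring.
have mulrE (u z w P v : F) : u * z * w * P * v = u * P * (z * w * v) by ring.
rewrite mulrE aqE {mulrE}.
rewrite exprMn [(-1) ^+ k.+1]exprS.
(* With these quantities made atoms, the only inverse [field] meets is that of [q ^+ m.+1]. *)
move: (pq_binom p q n k.+1) (pq_binom p q n k) (p ^+ k.+1) => b c P.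
have := expf_neq0 m.+1 q_neq0; move: (q ^+ m.+1) => Qm Qm_neq0.
move: (q ^- 'C(k, 2)) (q ^- k) => B Q.
by field.
Qed.

(** Solve the last factor of [pq_pow p q a x k.+1] for [x]. *)
Lemma mul_pq_pow a x k :
  x * pq_pow p q a x k =
  q ^- k * p ^+ k * a * pq_pow p q a x k - q ^- k * pq_pow p q a x k.+1.
Proof. by rewrite pq_powS; field; rewrite expf_neq0. Qed.

Lemma pq_taylor_expn a x n :
  x ^+ n = \sum_(0 <= k < n.+1) pq_taylor_coef a n k * pq_pow p q a x k.
Proof.
elim: n => [|n IHn].
  by rewrite big_nat1 pq_taylor_coef0 /pq_pow big_nil !expr0 mulr1.
rewrite exprS IHn mulr_sumr.
(* [A k] stays in degree [k], while [B k] moves up to degree [k.+1]. *)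
pose A k := pq_taylor_coef a n k * q ^- k * p ^+ k * a * pq_pow p q a x k.
pose B k := - (pq_taylor_coef a n k * q ^- k * pq_pow p q a x k.+1).
rewrite (eq_bigr (fun k => A k + B k)) => [|k _]; last first.
  by rewrite mulrCA mul_pq_pow /A /B mulrBr !mulrA.
(* Detaching [A 0] and [B n] pairs [A k.+1] with [B k]; the right side is cut at degrees 0 and
   [n.+1] to match. *)
rewrite big_split /= big_nat_recl // [X in _ + X]big_nat_recr //=.
rewrite [RHS]big_nat_recl // [X in _ = _ + X]big_nat_recr //=.
rewrite -addrA [X in _ + X]addrA -big_split /=; congr (_ + (_ + _)).
- by rewrite /A !pq_taylor_coef0 !expr0 invr1 !mulr1 -exprSr.
- apply: eq_big_nat => k /andP[_ lt_kn].
  by rewrite /A /B pq_taylor_coefS // mulrBl.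
- by rewrite /B pq_taylor_coefnn mulNr.
Qed.

End PQTaylor.

Theorem corollary2 (R : realType) (p q : R[i])
    (hp : p != 0) (hq : q != 0)
    (hpq : forall m : nat, (1 <= m)%N -> p ^+ m != q ^+ m)
    (n : nat) (a x : R[i]) :
  x ^+ n = \sum_(0 <= k < n.+1)
    (-1) ^+ k * q ^- 'C(k, 2) * pq_binom p q n k
      * (a * q ^- k) ^+ (n - k) * pq_pow p q a x k.
Proof. exact: pq_taylor_expn. Qed.
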